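(* Let $0<\beta<1$ and let $\{T_n\}$ be a dyadic martingale with $\sup_n 2^{-n\beta}\|T_n-T_{n-1}\|_\infty\le1$ (supremum over $n\ge1$). (a) For $0<\gamma<1$, let $G(\gamma)$ be the set of points $x\in\mathbb{R}$ such that $$\limsup_{N\to\infty}\frac1N\#\{1\le k\le N:2^{-k\beta}T_k(x)\ge\gamma\}=1.$$ Then $H^{\Phi(\gamma(1-2^{-\beta}))}(G(\gamma))\le1$ and consequently $\dim G(\gamma)\le\Phi(\gamma(1-2^{-\beta}))$. (b) For $0<\gamma<1$, let $F(\gamma)$ be the set of points $x\in\mathbb{R}$ such that $$\liminf_{k\to\infty}2^{-k\beta}T_k(x)\ge\gamma.$$ Then $H^{\Phi(\gamma(1-2^{-\beta}))}(F(\gamma))\le1$ and consequently $\dim F(\gamma)\le\Phi(\gamma(1-2^{-\beta}))$. (c) At almost every point $x\in\mathbb{R}$ (with respect to Lebesgue measure) such that there exists a constant $\delta=\delta(x)>0$ with $$\limsup_{N\to\infty}\frac1N\#\{1\le k\le N:2^{-k\beta}T_k(x)>\delta\}>0,$$ there exists a constant $c=c(x)>0$ such that $$\limsup_{N\to\infty}\frac1N\#\{1\le k\le N:2^{-k\beta}T_k(x)<-c\}>0.$$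
   Context: For $k=0,1,2,\dots$ let $\mathcal{D}_k$ be the collection of dyadic intervals $[j2^{-k},(j+1)2^{-k})$, $j\in\mathbb{Z}$. A dyadic martingale is a sequence $\{T_k\}_{k\ge0}$ of locally integrable real functions on $\mathbb{R}$ such that, for every $k\geq 0$, $T_k$ is constant on each interval of $\mathcal{D}_k$ and $\int_I(T_{k+1}(x)-T_k(x))\,dx=0$ for every $I\in\mathcal{D}_k$. The symbol $\#$ denotes cardinality. The entropy function is $$\Phi(\eta)=\frac{1+\eta}{2}\log_2\Big(\frac{2}{1+\eta}\Big)+\frac{1-\eta}{2}\log_2\Big(\frac{2}{1-\eta}\Big),\quad 0<\eta<1.$$ For $0<s\le1$, $H^s(E)=\lim_{\delta\to0}H^s_\delta(E)$ is the dyadic Hausdorff measure, where $H^s_\delta(E)=\inf\sum|I_j|^s$, the infimum being over all collections of dyadic intervals $\{I_j\}$ (elements of $\bigcup_k\mathcal{D}_k$) with $|I_j|<\delta$ and $E\subset\bigcup I_j$. The Hausdorff dimension $\dim(E)$ is the infimum of the indices $s>0$ with $H^s(E)<\infty$. *)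

(* Defs.v *)
From HB Require Import structures.
From mathcomp Require Import all_boot all_order all_algebra.
From mathcomp Require Import all_classical all_reals all_analysis.

Set Implicit Arguments.
Unset Strict Implicit.
Unset Printing Implicit Defensive.

Import Order.TTheory GRing.Theory Num.Theory.
Import numFieldNormedType.Exports.

Local Open Scope classical_set_scope.
Local Open Scope ring_scope.

(* The library's [dyadic_itv] is indexed by naturals, hence only covers the
   half-line [0, +oo[; here [j] ranges over all integers. *)
Definition dyadic (R : realType) (k : nat) (j : int) : set R :=
  `[j%:~R * 2 ^- k, (j + 1)%:~R * 2 ^- k[.

Definition dyadic_martingale (R : realType) (T : nat -> R -> R) : Prop :=
  forall k : nat,
    [/\ locally_integrable [set: R] (T k),
        forall (j : int) (x y : R),
          dyadic k j x -> dyadic k j y -> T k x = T k y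
      & forall j : int,
          (\int[lebesgue_measure]_(x in dyadic k j)
             (T k.+1 x - T k x)%:E = 0)%E].

Definition log2 (R : realType) (x : R) : R := ln x / ln 2.

Definition entropy (R : realType) (eta : R) : R :=
  (1 + eta) / 2 * log2 (2 / (1 + eta)) + (1 - eta) / 2 * log2 (2 / (1 - eta)).

(* A collection of dyadic intervals is encoded by the set [C] of its indices
   (k, j); the interval with index (k, j) has length 2 ^- k. *)
Definition dyadic_cover (R : realType) (delta : R) (E : set R)
    (C : set (nat * int)) : Prop :=
  (forall p, C p -> 2 ^- p.1 < delta) /\
  E `<=` \bigcup_(p in C) dyadic p.1 p.2.

Definition hausdorff_content (R : realType) (s delta : R) (E : set R) : \bar R :=
  ereal_inf [set (\esum_(p in C) ((2 ^- p.1 : R) `^ s)%:E)%E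
            | C in dyadic_cover delta E].

Definition hausdorff_measure (R : realType) (s : R) (E : set R) : \bar R :=
  lim (hausdorff_content s delta E @[delta --> 0^'+]).

(* Exponents s > 1 are allowed so that the infimum is never over the empty set;
   this only affects sets E with H^s(E) = +oo for every s in ]0, 1], such as the
   whole line, which get dimension 1. *)
Definition hausdorff_dim (R : realType) (E : set R) : \bar R :=
  ereal_inf [set s%:E | s in [set s : R | 0 < s /\
                                   (hausdorff_measure s E < +oo)%E]].

Definition upper_density (R : realType) (P : pred nat) : \bar R :=
  limn_esup (fun N : nat =>
    (N%:R^-1 * #|[pred k : 'I_N.+1 | (1 <= k)%N && P k]|%:R : R)%:E).

Definition normalized (R : realType) (beta : R) (T : nat -> R -> R)
    (k : nat) (x : R) : R :=
  2 `^ (- (k%:R * beta)) * T k x.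

Definition G_set (R : realType) (beta : R) (T : nat -> R -> R) (gamma : R) :
    set R :=
  [set x | upper_density R (fun k => gamma <= normalized beta T k x) = 1%E].

Definition F_set (R : realType) (beta : R) (T : nat -> R -> R) (gamma : R) :
    set R :=
  [set x | (gamma%:E <= limn_einf (fun k => (normalized beta T k x)%:E))%E].

(* Main.v *)
Require Import Defs.
From mathcomp Require Import all_boot all_order all_algebra.
From mathcomp Require Import all_classical all_reals all_analysis.
From mathcomp Require Import measurable_realfun ess_sup_inf.
From mathcomp Require Import ring lra zify.

Set Implicit Arguments.
Unset Strict Implicit.
Unset Printing Implicit Defensive.

Import Order.TTheory GRing.Theory Num.Theory.
Import numFieldNormedType.Exports.

Local Open Scope classical_set_scope.
Local Open Scope ring_scope.

(* Put q = 2^-beta, a_k = 2^(-k beta) T_k and b_k = a_(k+1) - q a_k. The b_k are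
   the increments of a dyadic martingale and |b_k| <= 1, so for 0 < t < 1 the
   products prod_(k < n) (1 + t b_k) form a positive martingale; if such a
   product exceeds 2^(n (1 - s)) e^(kappa n) for infinitely many n at every
   point of E, then covering E by all the dyadic intervals where this happens
   shows that H^s(E) = 0.

   With eta = gamma (1 - q), a point of F(gamma) or G(gamma) has, for infinitely
   many n, sum_(k < n) (gamma - a_k)^+ = o(n), so the average of the b_k is at
   least eta - o(1). By concavity, ln (1 + eta b) lies above its chord over
   [-1, 1], whose value at eta is (1 - Phi(eta)) ln 2. This alone does not reach
   the critical exponent, and a bound H^Phi(eta) <= 1 on the whole line requires
   H^Phi(eta) = 0 on each unit interval. The required exponential gain comes
   from strict concavity, which adds a multiple of 1 - b^2: since eta < 1, either
   b_k stays near eta, away from 1 in absolute value, or the average of the a_k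
   exceeds gamma by a definite amount.

   For (c), the same covering with s = 1 gives limsup (1/n) sum b_k <= 0 almost
   everywhere, hence limsup (1/n) sum a_k <= 0; as the a_k are bounded, a
   positive upper density of {a_k > delta} forces one of {a_k < -c}. *)

(** * Logarithmic inequalities *)

(** Applying [ln z <= z - 1] to the square root [s] of [y] gains [(s - 1) ^+ 2], and
    [(s + 1) ^+ 2 <= 2 * (y + 1)] turns this into a multiple of [(y - 1) ^+ 2]. *)
Lemma ln_le_sub_sqr (R : realType) (y : R) : 0 < y ->
  ln y <= y - 1 - (y - 1) ^+ 2 / (2 * (y + 1)).
Proof.
move=> y0; set s := Num.sqrt y.
have s0 : 0 < s by rewrite sqrtr_gt0.
have ys : y = s ^+ 2 by rewrite sqr_sqrtr // ltW.
have lns : ln y <= 2 * (s - 1).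
  rewrite ys lnXn // mulr2n.
  have : ln (1 + (s - 1)) <= s - 1 by apply: le_ln1Dx; lra.
  by rewrite (_ : 1 + (s - 1) = s); [lra|ring].
apply: (le_trans lns); rewrite lerBrDl -lerBrDr ys.
rewrite ler_pdivrMr; last by nra.
have -> : (s ^+ 2 - 1) ^+ 2 = (s - 1) ^+ 2 * (s + 1) ^+ 2 by ring.
have -> : (s ^+ 2 - 1 - 2 * (s - 1)) * (2 * (s ^+ 2 + 1)) =
  (s - 1) ^+ 2 * (2 * (s ^+ 2 + 1)) by ring.
apply: ler_wpM2l; first exact: sqr_ge0.
have := sqr_ge0 (s - 1); nra.
Qed.

(** The preceding bound at [x / c]; the constant 16 bounds [2 * c * (x + c)] when [x] and [c] are at
    most 2. *)
Lemma ln_le_tangent (R : realType) (x c : R) : 0 < x <= 2 -> 0 < c <= 2 ->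
  ln x <= ln c + (x - c) / c - (x - c) ^+ 2 / 16.
Proof.
move=> /andP[x0 x2] /andP[c0 c2].
have xc0 : 0 < x / c by rewrite divr_gt0.
have := ln_le_sub_sqr xc0.
rewrite ln_div ?posrE //.
have -> : x / c - 1 = (x - c) / c by field; lra.
have -> : ((x - c) / c) ^+ 2 / (2 * (x / c + 1)) =
          (x - c) ^+ 2 / (2 * c * (x + c)) by field; lra.
have : (x - c) ^+ 2 / 16 <= (x - c) ^+ 2 / (2 * c * (x + c)).
  apply: ler_wpM2l; first exact: sqr_ge0.
  rewrite lef_pV2 ?posrE; nra.
lra.
Qed.

(* The strict concavity of [ln] yields the gain [eta ^+ 2 / 16 * (1 - b ^+ 2)]
   over the chord joining the values at [b = -1] and [b = 1]. *)
Lemma ln_ge_chord (R : realType) (eta b : R) : 0 < eta < 1 -> -1 <= b <= 1 ->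
  (1 + b) / 2 * ln (1 + eta) + (1 - b) / 2 * ln (1 - eta)
    + eta ^+ 2 / 16 * (1 - b ^+ 2) <= ln (1 + eta * b).
Proof.
move=> /andP[e0 e1] /andP[b0 b1].
have c0 : 0 < 1 + eta * b by nra.
have c2 : 1 + eta * b <= 2 by nra.
have hA : ln (1 + eta) <= ln (1 + eta * b) + eta * (1 - b) / (1 + eta * b)
    - (eta * (1 - b)) ^+ 2 / 16.
  have := @ln_le_tangent R (1 + eta) (1 + eta * b).
  rewrite (_ : 1 + eta - (1 + eta * b) = eta * (1 - b)); last ring.
  by apply; apply/andP; split; lra.
have hB : ln (1 - eta) <= ln (1 + eta * b) - eta * (1 + b) / (1 + eta * b)
    - (eta * (1 + b)) ^+ 2 / 16.
  have := @ln_le_tangent R (1 - eta) (1 + eta * b).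
  rewrite (_ : 1 - eta - (1 + eta * b) = - (eta * (1 + b))); last ring.
  by rewrite mulNr sqrrN; apply; apply/andP; split; lra.
have pb : 0 <= (1 + b) / 2 by lra.
have nb : 0 <= (1 - b) / 2 by lra.
have := ler_wpM2l pb hA; have := ler_wpM2l nb hB.
set X := ln (1 + eta * b); set c := (1 + eta * b)^-1.
(* The tangent bounds at [1 + eta] and [1 - eta] are averaged with the weights whose barycentre is
   [1 + eta * b], so the first-order terms cancel. *)
have hb : (1 + b) / 2 * (X + eta * (1 - b) * c - (eta * (1 - b)) ^+ 2 / 16) +
  (1 - b) / 2 * (X - eta * (1 + b) * c - (eta * (1 + b)) ^+ 2 / 16) =
  X - eta ^+ 2 / 16 * (1 - b ^+ 2) by field.
lra.
Qed.

(** Value at [b = eta] of the chord of [ln (1 + eta * b)] over [-1, 1]. *)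
Definition chord (R : realType) (eta : R) : R :=
  (1 + eta) / 2 * ln (1 + eta) + (1 - eta) / 2 * ln (1 - eta).

Lemma chord_entropy (R : realType) (eta : R) : 0 < eta < 1 ->
  chord eta = (1 - entropy eta) * ln 2.
Proof.
move=> /andP[e0 e1].
have l2 : ln 2 != 0 :> R by rewrite gt_eqF // ln_gt0 //; lra.
rewrite /chord /entropy /log2 !ln_div ?posrE; try lra.
by field.
Qed.

Lemma entropy_gt0 (R : realType) (eta : R) : 0 < eta < 1 -> 0 < entropy eta.
Proof.
move=> /andP[e0 e1].
have l2 : 0 < ln 2 :> R by rewrite ln_gt0 //; lra.
rewrite /entropy /log2 addr_gt0 // mulr_gt0 ?divr_gt0 ?ln_gt0 //; try lra.
  by rewrite ltr_pdivlMr; lra.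
by rewrite ltr_pdivlMr; lra.
Qed.

(** Since [y - q * x] equals [eta] at [x = y = gamma], its distance to [eta] is controlled by the
    deviations of [x] and [y] from [gamma], and [1 - b ^+ 2] falls below [1 - eta ^+ 2] by at most
    twice that distance. The parameter [m] allows a smaller gain than the full [eta ^+ 2 / 16]. *)
Lemma ln_step_ge (R : realType) (q gamma m x y : R) :
  0 < q < 1 -> 0 < gamma < 1 -> `|y - q * x| <= 1 ->
  0 <= m <= (gamma * (1 - q)) ^+ 2 / 16 ->
  let eta := gamma * (1 - q) in
  let sigma := (ln (1 + eta) - ln (1 - eta)) / 2 in
  chord eta + sigma * ((y - gamma) - q * (x - gamma)) + m * (1 - eta ^+ 2)
    - 2 * m * ((y - gamma + 2 * Num.max 0 (gamma - y)) +
               q * (x - gamma + 2 * Num.max 0 (gamma - x)))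
  <= ln (1 + eta * (y - q * x)).
Proof.
move=> /andP[q0 q1] /andP[g0 g1] b1 /andP[m0 m1]; set eta := gamma * (1 - q).
rewrite /=; set sigma : R := (_ - _) / 2.
have eta0 : 0 < eta by rewrite /eta; nra.
have eta1 : eta < 1 by rewrite /eta; nra.
move: b1; rewrite ler_norml => b1.
have := @ln_ge_chord R eta (y - q * x); rewrite eta0 eta1 => /(_ isT b1).
apply: le_trans.
have absE (t : R) : t + 2 * Num.max 0 (- t) = `|t|.
  by case: (lerP 0 t) => ht; [rewrite max_l ?ger0_norm|rewrite max_r ?ltr0_norm]; lra.
have -> : gamma - y = - (y - gamma) by ring.
have -> : gamma - x = - (x - gamma) by ring.
rewrite !absE; set b := y - q * x in b1 *.
have bE : b = eta + ((y - gamma) - q * (x - gamma)) by rewrite /b /eta; ring.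
have hu : `|b - eta| <= `|y - gamma| + q * `|x - gamma|.
  rewrite bE addrC addKr (le_trans (ler_normB _ _)) // normrM (gtr0_norm q0) //.
have hb : b ^+ 2 <= eta ^+ 2 + 2 * `|b - eta|.
  rewrite -lerBlDl subr_sqr mulrC (le_trans (ler_norm _)) // normrM.
  apply: ler_wpM2r => //; rewrite ler_norml; move/andP: b1 => [? ?]; lra.
have hm : m * (1 - eta ^+ 2 - 2 * (`|y - gamma| + q * `|x - gamma|)) <=
    eta ^+ 2 / 16 * (1 - b ^+ 2).
  apply: (@le_trans _ _ (m * (1 - b ^+ 2))).
    by apply: ler_wpM2l => //; lra.
  by apply: ler_wpM2r => //; move/andP: b1 => [? ?]; nra.
apply: le_trans (_ : _ <= chord eta + sigma * (b - eta) +
  m * (1 - eta ^+ 2 - 2 * (`|y - gamma| + q * `|x - gamma|))) _.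
  by rewrite bE; lra.
apply: lerD hm; rewrite le_eqVlt; apply/orP; left; apply/eqP.
by rewrite /chord /sigma; field.
Qed.

(* The idea is [`|a k - gamma| = (a k - gamma) + 2 * max 0 (gamma - a k)]: the
   gain [m * (1 - b ^+ 2)] is lost only where [a k] exceeds [gamma], and there
   the slope [sigma] of the chord compensates for it. *)
Lemma sum_ln_ge (R : realType) (q gamma : R) : 0 < q < 1 -> 0 < gamma < 1 ->
  exists kappa rho : R, [/\ 0 < kappa, 0 < rho &
    forall (a : nat -> R) (A : R), (forall k, `|a k| <= A) ->
      (forall k, `|a k.+1 - q * a k| <= 1) ->
    exists N0 : nat, forall N, (N0 <= N)%N ->
      \sum_(k < N) Num.max 0 (gamma - a k.+1) <= rho * N%:R ->
      N%:R * (chord (gamma * (1 - q)) + kappa) <=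
      \sum_(k < N) ln (1 + gamma * (1 - q) * (a k.+1 - q * a k))].
Proof.
move=> q01 g01; have [/andP[q0 q1] /andP[g0 g1]] := (q01, g01).
set eta := gamma * (1 - q).
have eta0 : 0 < eta by rewrite /eta; nra.
have eta1 : eta < 1 by rewrite /eta; nra.
have [sigma sigmaE] : exists sigma : R, sigma = (ln (1 + eta) - ln (1 - eta)) / 2.
  by eexists.
have sigma0 : 0 < sigma.
  rewrite sigmaE.
  by rewrite divr_gt0 // subr_gt0 ltr_ln ?posrE; lra.
(* The first bound is what [ln_step_ge] demands; the second keeps the coefficient
   [sigma * (1 - q) - 2 * m * (1 + q)] of the sum [U] nonnegative. *)
pose m := Num.min (eta ^+ 2 / 16) (sigma * (1 - q) / (2 * (1 + q))).
have m0 : 0 < m.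
  by rewrite lt_min !divr_gt0 ?mulr_gt0 ?exprn_gt0 //; lra.
have m1 : m <= eta ^+ 2 / 16 by rewrite ge_min lexx.
have m2 : 2 * m * (1 + q) <= sigma * (1 - q).
  have : m <= sigma * (1 - q) / (2 * (1 + q)) by rewrite ge_min lexx orbT.
  by rewrite ler_pdivlMr; lra.
pose c := m * (1 - eta ^+ 2).
have c0 : 0 < c by rewrite /c mulr_gt0 //; nra.
(* Of the gain [c] per step, half is kept as [kappa]; one quarter pays for the deficits and one for
   the boundary terms, bounded by [K]. *)
exists (c / 2), (c / 4 / (sigma + 8 * m)); split; first lra.
  by rewrite !divr_gt0 //; lra.
move=> a A aA ab.
pose u k := a k - gamma; pose v k : R := Num.max 0 (gamma - a k).
have v0 k : 0 <= v k by rewrite le_max lexx.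
have vu k : - u k <= v k by rewrite /u opprB le_max lexx orbT.
have uA k : `|u k| <= A + 1.
  by rewrite (le_trans (ler_normB _ _)) // lerD // ger0_norm; lra.
have A0 : 0 <= A by exact: le_trans (normr_ge0 _) (aA 0%N).
have vA : v 0%N <= A + 1.
  have := aA 0%N; rewrite ler_norml => /andP[? ?].
  by rewrite /v ge_max; apply/andP; split; lra.
pose K := (sigma + 8 * m) * 4 * (A + 1).
exists (Num.truncn (K / (c / 4))).+1 => N hN hV.
have KN : K <= c / 4 * N%:R.
  rewrite mulrC -ler_pdivrMr; last lra.
  by rewrite ltW // (lt_le_trans (truncnS_gt _)) // ler_nat.
set V := \sum_(k < N) _ in hV.
have {}hV : (sigma + 8 * m) * V <= c / 4 * N%:R.
  rewrite mulrC -ler_pdivlMr; last lra.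
  by rewrite mulrAC.
pose U := \sum_(k < N) u k.+1.
have V0 : 0 <= V by apply: sumr_ge0 => i _; exact: v0.
have UV : - U <= V by rewrite -sumrN; apply: ler_sum => i _; exact: vu.
have hsum : \sum_(k < N) (chord eta + c + sigma * (u k.+1 - q * u k) -
      2 * m * ((u k.+1 + 2 * v k.+1) + q * (u k + 2 * v k))) <=
    \sum_(k < N) ln (1 + eta * (a k.+1 - q * a k)).
  apply: ler_sum => k _; have := @ln_step_ge R q gamma m (a k) (a k.+1) q01 g01.
  move=> /(_ (ab k)) H; apply: le_trans (H _); last by rewrite m1 ltW.
  by rewrite le_eqVlt; apply/orP; left; apply/eqP; rewrite /c /u /v sigmaE /eta; ring.
apply: le_trans hsum.
(* The unshifted sum of [u k] is [U + u 0 - u N], and likewise for [v], so only boundary terms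
   separate it from the shifted one. *)
have -> : \sum_(k < N) (chord eta + c + sigma * (u k.+1 - q * u k) -
      2 * m * ((u k.+1 + 2 * v k.+1) + q * (u k + 2 * v k))) =
   N%:R * (chord eta + c) + sigma * (U - q * (U + u 0%N - u N)) -
   2 * m * ((U + 2 * V) + q * (U + u 0%N - u N + 2 * (V + v 0%N - v N))).
  rewrite /U /V -/(v _) {hN hV KN U V V0 UV}; elim: N => [|n IH].
    by rewrite !big_ord0; ring.
  by rewrite !big_ord_recr /= IH -natr1 -/(v _); ring.
have := uA 0%N; have := uA N; rewrite !ler_norml => /andP[u1 u2] /andP[u3 u4].
have U3 : - ((sigma * (1 - q) - 2 * m * (1 + q)) * V) <=
    (sigma * (1 - q) - 2 * m * (1 + q)) * U.
  by rewrite -mulrN; apply: ler_wpM2l; lra.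
have sq : 0 <= sigma * q by nra.
have mq : 0 <= m * q by nra.
have sq1 : sigma * q <= sigma by nra.
have mq1 : m * q <= m by nra.
have v0N := v0 N.
have h1 : sigma * q * (u 0%N - u N) <= sigma * (2 * (A + 1)).
  apply: (@le_trans _ _ (sigma * q * (2 * (A + 1)))).
    by apply: ler_wpM2l => //; lra.
  by apply: ler_wpM2r => //; lra.
have h2 : m * q * (u 0%N - u N) <= m * (2 * (A + 1)).
  apply: (@le_trans _ _ (m * q * (2 * (A + 1)))).
    by apply: ler_wpM2l => //; lra.
  by apply: ler_wpM2r => //; lra.
have h3 : m * q * (v 0%N - v N) <= m * (A + 1).
  apply: (@le_trans _ _ (m * q * (A + 1))).
    by apply: ler_wpM2l => //; lra.
  by apply: ler_wpM2r => //; lra.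
have h5 : sigma * (1 - q) * V <= sigma * V by apply: ler_wpM2r => //; lra.
have h6 : m * q * V <= m * V by exact: ler_wpM2r.
have p1 : 0 <= m * V by apply: mulr_ge0 => //; lra.
have p2 : 0 <= m * q * V by apply: mulr_ge0.
have p3 : 0 <= m * (A + 1) by apply: mulr_ge0; lra.
have p4 : 0 <= sigma * (A + 1) by apply: mulr_ge0; lra.
rewrite /K in KN; lra.
Qed.

(** * Dyadic intervals and coverings *)

Definition dyadic_index (R : realType) (k : nat) (x : R) : int :=
  Num.floor (2 ^+ k * x).

Lemma dyadicP (R : realType) (k : nat) (j : int) (x : R) :
  dyadic k j x <-> dyadic_index k x = j.
Proof.
have k0 : 0 < 2 ^+ k :> R by rewrite exprn_gt0.
have -> : (dyadic_index k x = j) <-> (j%:~R <= 2 ^+ k * x < (j + 1)%:~R).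
  by rewrite -floor_eq; split => /eqP.
by rewrite /dyadic /= in_itv /= ler_pdivrMr // ltr_pdivlMr // mulrC.
Qed.

Lemma dyadic_indexE (R : realType) (k : nat) (x : R) :
  dyadic_index k x = (dyadic_index k.+1 x %/ 2)%Z.
Proof.
have := floor_itv (2 ^+ k.+1 * x); rewrite -/(dyadic_index k.+1 x).
set i := dyadic_index k.+1 x => /andP[i1 i2]; apply/eqP; rewrite floor_eq.
have iE : i = (i %/ 2)%Z * 2 + (i %% 2)%Z := divz_eq i 2.
have r0 : 0 <= (i %% 2)%Z by rewrite modz_ge0.
have r1 : (i %% 2)%Z <= 1 by have := ltz_pmod i (isT : 0 < 2 :> int); lia.
have h1 : (i %/ 2)%Z%:~R * 2 <= i%:~R :> R by rewrite (_ : 2 = (2 : int)%:~R :> R) // -intrM ler_int; lia.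
have h2 : (i + 1)%:~R <= ((i %/ 2)%Z + 1)%:~R * 2 :> R.
  by rewrite (_ : 2 = (2 : int)%:~R :> R) // -intrM ler_int; lia.
rewrite exprS -mulrA in i1 i2; lra.
Qed.

Lemma dyadic_index_anti (R : realType) (k n : nat) (x y : R) : (k <= n)%N ->
  dyadic_index n x = dyadic_index n y -> dyadic_index k x = dyadic_index k y.
Proof.
move=> /subnK <-; elim: (n - k)%N => [//|d IH]; rewrite addSn => E.
by apply: IH; rewrite (dyadic_indexE _ x) (dyadic_indexE _ y) E.
Qed.

(** The left endpoint serves as the canonical point at which a function constant on the interval is
    evaluated. *)
Definition dyadic_point (R : realType) (k : nat) (j : int) : R :=
  j%:~R * 2 ^- k.

Lemma dyadic_pointK (R : realType) (k : nat) (j : int) :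
  dyadic_index k (dyadic_point R k j) = j.
Proof.
rewrite /dyadic_index /dyadic_point mulrCA divff ?mulr1 ?intrKfloor //.
Qed.

Lemma dyadic_point_left (R : realType) (k : nat) (j : int) :
  dyadic_point R k.+1 (2 * j) = dyadic_point R k j.
Proof.
have k0 : 2 ^+ k != 0 :> R by rewrite expf_neq0.
by rewrite /dyadic_point exprS intrM; field.
Qed.

Lemma dyadic_point_right (R : realType) (k : nat) (j : int) :
  dyadic_index k (dyadic_point R k.+1 (2 * j + 1)) = j.
Proof. by rewrite dyadic_indexE dyadic_pointK; lia. Qed.

Lemma dyadic_split (R : realType) (k : nat) (j : int) :
  dyadic k j = dyadic k.+1 (2 * j) `|` dyadic k.+1 (2 * j + 1) :> set R.
Proof.
apply/seteqP; split => x; rewrite /setU /= !dyadicP (dyadic_indexE k x); lia.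
Qed.

Lemma measurable_dyadic (R : realType) (k : nat) (j : int) :
  measurable (dyadic k j : set R).
Proof. exact: measurable_itv. Qed.

Lemma lebesgue_measure_dyadic (R : realType) (k : nat) (j : int) :
  lebesgue_measure (dyadic k j : set R) = (2 ^- k)%:E.
Proof.
have k0 : 0 < 2 ^- k :> R by rewrite invr_gt0 exprn_gt0.
rewrite lebesgue_measure_itv /= lte_fin ltr_pM2r // ltr_int ltrDl ltr01.
by rewrite -EFinD intrD mulrDl mul1r addrAC subrr add0r.
Qed.

Lemma le_esumZl (R : realType) (I : choiceType) (D : set I) (r : R)
    (a : I -> R) : 0 <= r -> (forall i, 0 <= a i) ->
  (\esum_(i in D) (r * a i)%:E <= r%:E * \esum_(i in D) (a i)%:E)%E.
Proof.
move=> r0 a0; apply: ge_ereal_sup => /= _ [X [finX XD] <-].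
under eq_fsbigr do rewrite EFinM.
rewrite -ge0_mule_fsumr; last by move=> i; rewrite lee_fin.
by apply: lee_wpmul2l; rewrite ?lee_fin //; apply: esum_ge; exists X.
Qed.

(** Groups the two halves of each dyadic interval, for the conservation of total mass between
    generations. *)
Lemma esum_int_parity (R : realType) (a : int -> R) :
  (forall j, 0 <= a j) ->
  (\esum_(j in [set: int]) (a j)%:E =
   \esum_(j in [set: int]) (a (2 * j)%R + a (2 * j + 1)%R)%:E)%E.
Proof.
move=> a0; rewrite (esumID [set 2 * j | j in [set: int]]); last first.
  by move=> j _; rewrite lee_fin.
rewrite setTI (_ : setT `&` _ = [set 2 * j + 1 | j in [set: int]]); last first.
  apply/seteqP; split => [j [_ jN]|_ [j _ <-]].
    exists (j %/ 2)%Z => //; apply: contrapT => jE; apply: jN.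
    by exists (j %/ 2)%Z => //; lia.
  by split => // -[i _]; lia.
rewrite esum_image; last by move=> i j _ _; lia.
rewrite esum_image; last by move=> i j _ _; lia.
by rewrite -esumD // => j _; rewrite lee_fin.
Qed.

Lemma esum_geometric_tail (R : realType) (r : R) (N : nat) : 0 < r < 1 ->
  (\esum_(n in [set n | N <= n]%N) (r ^+ n)%:E <= (r ^+ N / (1 - r))%:E)%E.
Proof.
move=> /andP[r0 r1].
rewrite -nneseries_esum; last by move=> n _; rewrite lee_fin exprn_ge0 ?ltW.
apply: lime_le.
  by apply: is_cvg_nneseries_cond => n _; rewrite lee_fin exprn_ge0 ?ltW.
apply: nearW => n; rewrite big_mkord sumEFin lee_fin.
rewrite -(big_mkord (fun i => N <= i)%N (fun i => r ^+ i)).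
rewrite ler_pdivlMr ?subr_gt0 //.
suff H k : (\sum_(0 <= i < N + k | (N <= i)%N) r ^+ i) * (1 - r) = r ^+ N - r ^+ (N + k).
  have [nN|/ltnW/subnKC <-] := leqP n N; last by rewrite H gerBl exprn_ge0 // ltW.
  rewrite big_nat_cond big1 ?mul0r ?exprn_ge0 ?ltW // => i; lia.
elim: k => [|k IH].
  by rewrite addn0 big_nat_cond big1 ?mul0r ?subrr // => i; lia.
rewrite addnS big_mkcond big_nat_recr //= -big_mkcond leq_addr mulrDl IH exprS; ring.
Qed.

Lemma esum_pickle_lty (R : realType) :
  (\esum_(j in [set: int]) (2 ^- (pickle j) : R)%:E < +oo)%E.
Proof.
have pinj : set_inj [set: int] (@pickle int) by move=> i j _ _; exact: (pcan_inj pickleK).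
rewrite -(@esum_image R _ _ [set: int] pickle (fun n => (2 ^- n)%:E)) //.
apply: (@le_lt_trans _ _ ((2^-1) ^+ 0 / (1 - 2^-1))%:E); last exact: ltry.
have h : 0 < (2^-1 : R) < 1 by lra.
apply: le_trans (esum_geometric_tail 0 h).
rewrite esum_mkcond [leRHS]esum_mkcond; apply: le_esum => n _.
rewrite [leRHS]ifT ?inE // exprVn.
by case: ifP => _; rewrite // lee_fin invr_ge0 exprn_ge0.
Qed.

(** A form of [H^s(E) = 0] without limits: a lower bound on the generation replaces the upper bound
    [delta] on the lengths. *)
Definition negligibly_covered (R : realType) (s : R) (E : set R) : Prop :=
  forall (e : R) (N : nat), 0 < e -> exists C : set (nat * int),
    [/\ forall p, C p -> (N <= p.1)%N,
        E `<=` \bigcup_(p in C) dyadic p.1 p.2 &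
        (\esum_(p in C) ((2 ^- p.1 : R) `^ s)%:E <= e%:E)%E].

(* [m n j] is the mass of the interval with index [(n, j)]. All intervals of
   generation at least [N1] that satisfy the mass inequality are used, without
   any stopping rule: the factor [r ^+ n] makes the sum over generations
   converge. *)
Lemma dyadic_coverage (R : realType) (m : nat -> int -> R) (r s : R)
    (E : set R) :
  0 < r < 1 -> (forall n j, 0 <= m n j) ->
  (forall n j, m n.+1 (2 * j) + m n.+1 (2 * j + 1) = m n j) ->
  (\esum_(j in [set: int]) (m 0 j)%:E < +oo)%E ->
  (forall x, E x -> forall N, exists2 n, (N <= n)%N &
     (2 ^- n) `^ s <= r ^+ n * m n (dyadic_index n x)) ->
  negligibly_covered s E.
Proof.
move=> r01 m0 mS mfin Em e N e0; have /andP[r0 r1] := r01.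
have level n :
  (\esum_(j in [set: int]) (m n j)%:E = \esum_(j in [set: int]) (m 0 j)%:E)%E.
  elim: n => [//|n <-]; rewrite esum_int_parity //.
  by apply: eq_esum => j _; rewrite mS.
set M := (\esum_(j in setT) _)%E in mfin level.
have M0 : (0 <= M)%E by apply: esum_ge0 => j _; rewrite lee_fin.
have Mfin : M = (fine M)%:E by rewrite fineK // ge0_fin_numE.
have fM0 : 0 <= fine M by rewrite fine_ge0.
have [N1 NN1 N1e] : exists2 N1, (N <= N1)%N & fine M * (r ^+ N1 / (1 - r)) <= e.
  have cv : fine M * (r ^+ n / (1 - r)) @[n --> \oo] --> fine M * (0 / (1 - r)).
    apply: cvgM; first exact: cvg_cst.
    apply: cvgM; last exact: cvg_cst.
    by apply: cvg_expr; rewrite gtr0_norm.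
  rewrite mul0r mulr0 in cv.
  have [N2 _ hN2] := cvgr_le _ cv _ e0.
  by exists (maxn N N2); [exact: leq_maxl|apply: hN2; exact: leq_maxr].
pose C := [set p : nat * int | (N1 <= p.1)%N /\ (2 ^- p.1) `^ s <= r ^+ p.1 * m p.1 p.2].
exists C; split.
- by move=> p [? _]; lia.
- move=> x /Em /(_ N1)[n nN h]; exists (n, dyadic_index n x) => //=.
  by rewrite dyadicP.
(* By the mass inequality, the cost of [C] is at most the sum of [r ^+ n * m n j] over all intervals
   of generation at least [N1]. *)
- apply: (@le_trans _ _ (\esum_(p in [set n | (N1 <= n)%N] `*`` (fun=> [set: int]))
     (r ^+ p.1 * m p.1 p.2)%:E)%E).
    rewrite esum_mkcond [leRHS]esum_mkcond; apply: le_esum => -[n j] _.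
    case: ifPn => [|_].
      by rewrite inE => -[/= nN h]; rewrite ifT ?lee_fin // inE.
    by case: ifP => _ //; rewrite lee_fin mulr_ge0 ?exprn_ge0 // ltW.
  rewrite -(@esum_esum R nat int [set n | (N1 <= n)%N] (fun=> setT)
     (fun n j => (r ^+ n * m n j)%:E)); last first.
    by move=> n j _ _; rewrite lee_fin mulr_ge0 ?exprn_ge0 // ltW.
  apply: (@le_trans _ _ (\esum_(n in [set n | (N1 <= n)%N]) (fine M * r ^+ n)%:E)%E).
    apply: le_esum => n _; apply: le_trans (le_esumZl _ _ _) _ => //.
      by rewrite exprn_ge0 // ltW.
    by rewrite level -/M Mfin -EFinM mulrC.
  apply: le_trans (le_esumZl _ _ _) _ => //; first by move=> n; rewrite exprn_ge0 // ltW.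
  apply: (@le_trans _ _ ((fine M)%:E * (r ^+ N1 / (1 - r))%:E)%E).
    by apply: lee_wpmul2l; rewrite ?lee_fin //; exact: esum_geometric_tail.
  by rewrite -EFinM lee_fin.
Qed.

Lemma eventually_exp_half_lt (R : realType) (d : R) : 0 < d -> exists N, forall n,
  (N <= n)%N -> 2 ^- n < d.
Proof.
move=> d0; have /cvgr_lt /(_ _ d0) [N _ hN] : (2^-1 : R) ^+ n @[n --> \oo] --> (0 : R).
  by apply: cvg_expr; rewrite gtr0_norm; lra.
by exists N => n Nn; rewrite -exprVn; exact: hN.
Qed.

Lemma hausdorff_measure_eq0 (R : realType) (s : R) (E : set R) :
  negligibly_covered s E -> hausdorff_measure s E = 0%E.
Proof.
move=> Ecov; apply: lim_near_cst => //; near=> d.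
have d0 : 0 < d by near: d; exact: nbhs_right_gt.
apply/eqP; rewrite eq_le; apply/andP; split.
  apply/lee_addgt0Pr => e e0; rewrite add0e.
  have [N hN] := eventually_exp_half_lt d0.
  have [C [CN EC Ce]] := Ecov _ N e0.
  apply: le_trans Ce; apply: ereal_inf_lbound; exists C => //.
  by split => // p /CN /hN.
apply: le_ereal_inf_tmp => _ [C _ <-].
by apply: esum_ge0 => p _; rewrite lee_fin powR_ge0.
Unshelve. all: by end_near. Qed.

(** For [s = 1] the cost of a cover is the sum of its lengths, so [E] lies in measurable sets of
    arbitrarily small measure. *)
Lemma lebesgue_negligible (R : realType) (E : set R) :
  negligibly_covered 1 E -> lebesgue_measure.-negligible E.
Proof.
move=> Ecov.
have cover (n : nat) : exists B : set R, [/\ measurable B, E `<=` B &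
    (lebesgue_measure B <= (n.+1%:R^-1)%:E)%E].
  have [C [_ EC Ce]] := Ecov n.+1%:R^-1 0%N ltac:(by rewrite invr_gt0 ltr0n).
  (* The cover is enumerated through [pickle]; codes outside [C] give the empty set. *)
  pose F i : set R := if pickle_inv i is Some p then
    if p \in C then dyadic p.1 p.2 else set0 else set0.
  have mF i : measurable (F i).
    rewrite /F; case: pickle_inv => // p; case: ifP => // _.
    exact: measurable_dyadic.
  exists (\bigcup_i F i); split.
  - exact: bigcup_measurable.
  - move=> x /EC [p Cp xp]; exists (pickle p) => //.
    by rewrite /F pickleK_inv mem_set.
  - apply: le_trans Ce.
    have mUF : measurable (\bigcup_i F i) by exact: bigcup_measurable.
    apply: (le_trans (measure_sigma_subadditive lebesgue_measure mF mUF _)) => //.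
    rewrite nneseries_esumT //.
    have -> : (\esum_(p in C) ((2 ^- p.1 : R) `^ 1)%:E =
        \esum_(i in [set pickle p | p in C]) lebesgue_measure (F i))%E.
      rewrite esum_image; last by move=> p q _ _; exact: (pcan_inj pickleK).
      apply: eq_esum => p Cp; rewrite /F pickleK_inv mem_set //.
      by rewrite lebesgue_measure_dyadic powRr1 // invr_ge0 exprn_ge0.
    rewrite esum_mkcond [leRHS]esum_mkcond; apply: le_esum => i _.
    rewrite in_setT; case: ifPn => // iC; rewrite /F.
    have := @pickle_invK (nat * int)%type i.
    case: (pickle_inv i) => [p|] /= iE; rewrite ?measure0 //.
    case: ifPn => pC; rewrite ?measure0 //; move/negP: iC => []; apply/mem_set.
    by exists p => //; exact/set_mem.
pose B n := projT1 (cid (cover n)).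
have BP n : [/\ measurable (B n), E `<=` B n &
    (lebesgue_measure (B n) <= (n.+1%:R^-1)%:E)%E] by rewrite /B; case: cid.
have mB : measurable (\bigcap_n B n).
  by apply: bigcap_measurable => // n _; case: (BP n).
exists (\bigcap_n B n); split => //; last by move=> x Ex n _; case: (BP n) => _ + _; exact.
apply/eqP; rewrite eq_le measure_ge0 andbT; apply/lee_addgt0Pr => e e0.
rewrite add0e; have [_ _ h] := BP (Num.truncn e^-1).
apply: (le_trans (le_measure _ _ _ (bigcap_inf (i := Num.truncn e^-1) _))) => //; rewrite ?inE //.
  by case: (BP (Num.truncn e^-1)).
apply: (le_trans h); rewrite lee_fin invf_ple ?posrE //.
by rewrite ltW // truncnS_gt.
Qed.

(** The factors [1 + t * b k] on the two halves of an interval average to 1, so [2 ^- n] times the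
    product is an additive mass, to which [dyadic_coverage] applies. *)
Lemma increments_coverage (R : realType) (b : nat -> R -> R) (t s kappa : R)
    (E : set R) :
  (forall k x y, dyadic_index k.+1 x = dyadic_index k.+1 y -> b k x = b k y) ->
  (forall k j, b k (dyadic_point R k.+1 (2 * j)) +
               b k (dyadic_point R k.+1 (2 * j + 1)) = 0) ->
  (forall k x, `|b k x| <= 1) ->
  0 < t < 1 -> 0 < kappa ->
  (forall x, E x -> forall N, exists2 n, (N <= n)%N &
     expR (n%:R * kappa) * (2 ^- n) `^ s <=
       2 ^- n * \prod_(k < n) (1 + t * b k x)) ->
  negligibly_covered s E.
Proof.
move=> bconst bsum b1 /andP[t0 t1] kappa0 hE.
(* The root weights [v] make the total mass of the line finite. *)
pose v (x : R) : R := 2 ^- pickle (dyadic_index 0 x).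
have v0 x : 0 < v x by rewrite invr_gt0 exprn_gt0.
have p0 k x : 0 <= 1 + t * b k x.
  by have := b1 k x; rewrite ler_norml => /andP[? ?]; nra.
pose w n x := 2 ^- n * v x * \prod_(k < n) (1 + t * b k x).
have wconst n x y : dyadic_index n x = dyadic_index n y -> w n x = w n y.
  move=> xy; rewrite /w /v (dyadic_index_anti (leq0n n) xy); congr (_ * _).
  apply: eq_bigr => k _; rewrite (bconst k x y) //.
  exact: dyadic_index_anti xy.
have h2 n : 0 < 2 ^- n :> R by rewrite invr_gt0 exprn_gt0.
(* Half of the exponential gain [kappa] provides the ratio; the other half outweighs the small
   factor [v x] once [n] is at least the [K] below. *)
have := @dyadic_coverage R (fun n j => w n (dyadic_point R n j))
  (expR (- (kappa / 2))) s E; apply.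
- by rewrite expR_gt0 expR_lt1 /=; lra.
- by move=> n j; rewrite /w mulr_ge0 ?prodr_ge0 // mulr_ge0 // ltW.
- move=> n j; pose x := dyadic_point R n.+1 (2 * j).
  pose y := dyadic_point R n.+1 (2 * j + 1).
  have xj : dyadic_index n x = dyadic_index n (dyadic_point R n j).
    by rewrite /x dyadic_point_left.
  have yj : dyadic_index n y = dyadic_index n (dyadic_point R n j).
    by rewrite /y dyadic_point_right dyadic_pointK.
  have wS z : w n.+1 z = w n z * ((1 + t * b n z) / 2).
    have : 2 ^+ n != 0 :> R by rewrite expf_neq0.
    by rewrite /w big_ord_recr /= exprS => ?; field.
  rewrite -/x -/y !wS (wconst _ _ _ xj) (wconst _ _ _ yj) -mulrDr.
  have := bsum n j; rewrite -/x -/y => /eqP; rewrite addr_eq0 => /eqP ->.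
  by rewrite -mulrDl mulrN (_ : 1 - _ + _ = 2) ?divff ?mulr1 //; ring.
- apply: le_lt_trans (esum_pickle_lty R); apply: le_esum => j _.
  by rewrite /w /v big_ord0 mulr1 dyadic_pointK expr0 invr1 mul1r.
- move=> x /hE Ex N.
  pose K := - ln (v x) / (kappa / 2).
  have [n nN hn] := Ex (maxn N (Num.truncn K).+1).
  have nN' : (N <= n)%N by apply: leq_trans nN; exact: leq_maxl.
  have nK : K <= n%:R.
    rewrite ltW // (lt_le_trans (truncnS_gt _)) // ler_nat.
    by apply: leq_trans nN; exact: leq_maxr.
  exists n => //; rewrite (wconst n _ x) ?dyadic_pointK // /w.
  rewrite ler_pdivrMr in nK; last lra.
  have vE : v x = expR (ln (v x)) by rewrite lnK // posrE.
  have -> : expR (- (kappa / 2)) ^+ n * (2 ^- n * v x * \prod_(k < n) (1 + t * b k x)) =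
      expR (n%:R * - (kappa / 2)) * v x * (2 ^- n * \prod_(k < n) (1 + t * b k x)).
    by rewrite expRM_natl; ring.
  rewrite {1}vE -expRD.
  apply: (@le_trans _ _ (expR (- (n%:R * kappa)) *
      (2 ^- n * \prod_(k < n) (1 + t * b k x)))).
    by rewrite expRN ler_pdivlMl ?expR_gt0.
  apply: ler_wpM2r; last by rewrite ler_expR; lra.
  by rewrite mulr_ge0 ?prodr_ge0 // ltW.
Qed.

(** * Upper densities *)

Lemma limn_esup_gt (R : realType) (u : nat -> \bar R) (l : \bar R) (N : nat) :
  (l < limn_esup u)%E -> exists2 n, (N <= n)%N & (l < u n)%E.
Proof.
move=> lu; have : (l < ereal_sup [set u n | n in [set n | (N <= n)%N]])%E.
  apply: (lt_le_trans lu); apply: ereal_inf_lbound.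
  by exists [set n | (N <= n)%N] => //; exists N.
by move=> /ereal_sup_gt [_ [n Nn <-] lun]; exists n.
Qed.

Lemma limn_esup_ge (R : realType) (u : nat -> \bar R) (l : \bar R) :
  (forall N, exists2 n, (N <= n)%N & (l <= u n)%E) -> (l <= limn_esup u)%E.
Proof.
move=> H; apply: le_ereal_inf_tmp => _ [A [N _ NA] <-].
have [n Nn lu] := H N; apply: (le_trans lu); apply: ereal_sup_ubound.
by exists n => //; exact: NA.
Qed.

Lemma limn_einf_lt (R : realType) (u : nat -> \bar R) (l : \bar R) :
  (l < limn_einf u)%E -> exists N, forall n, (N <= n)%N -> (l < u n)%E.
Proof.
rewrite /limn_einf lteNr => /ereal_inf_lt [_ [A [N _ NA] <-]] supA.
exists N => n Nn; rewrite -lteN2; apply: le_lt_trans supA.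
by apply: ereal_sup_ubound; exists n => //; exact: NA.
Qed.

Definition count_to (P : pred nat) (N : nat) : nat :=
  #|[pred k : 'I_N.+1 | (1 <= k)%N && P k]|.

Lemma count_toE (P : pred nat) (N : nat) :
  count_to P N = (\sum_(k < N) P k.+1)%N.
Proof.
rewrite /count_to -sum1_card big_mkcond /= big_ord_recl /= add0n.
by apply: eq_bigr => k _; rewrite inE /=; case: (P _).
Qed.

Lemma count_to_le (P : pred nat) (N : nat) : (count_to P N <= N)%N.
Proof.
rewrite count_toE -[leqRHS]muln1 -[X in (_ <= X * _)%N]card_ord -sum_nat_const.
by apply: leq_sum => k _; case: (P _).
Qed.

Lemma upper_density_gt (R : realType) (P : pred nat) (p : R) (N : nat) : 0 <= p ->
  (p%:E < upper_density R P)%E ->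
  exists2 n, (N <= n)%N & p * n%:R <= (count_to P n)%:R.
Proof.
(* Asking for [n > N] excludes [n = 0], where the quotient is 0 by the convention on inverses. *)
move=> p0 /(@limn_esup_gt _ _ _ N.+1) [n Nn]; rewrite lte_fin => pn.
exists n; first exact: ltnW.
have n0 : 0 < n%:R :> R by rewrite ltr0n; lia.
by rewrite mulrC in pn; rewrite -ler_pdivlMr // ltW.
Qed.

Lemma upper_density_ge (R : realType) (P : pred nat) (p : R) :
  (forall N, exists2 n, (N <= n)%N & p * n%:R <= (count_to P n)%:R) ->
  (p%:E <= upper_density R P)%E.
Proof.
move=> H; apply: limn_esup_ge => N; have [n Nn pn] := H N.+1.
exists n; first exact: ltnW.
have n0 : 0 < n%:R :> R by rewrite ltr0n; lia.
by rewrite lee_fin mulrC ler_pdivlMr.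
Qed.

(** * Dyadic martingales *)

Lemma dyadic_martingale_cst (R : realType) (T : nat -> R -> R) (k n : nat)
    (x y : R) : dyadic_martingale T -> (k <= n)%N ->
  dyadic_index n x = dyadic_index n y -> T k x = T k y.
Proof.
move=> mT kn /(dyadic_index_anti kn) xy; have [_ /(_ _ x y) + _] := mT k.
by apply; apply/dyadicP => //; rewrite xy.
Qed.

Lemma dyadic_martingale_mean (R : realType) (T : nat -> R -> R) (k : nat)
    (j : int) (x y z : R) : dyadic_martingale T ->
  dyadic k.+1 (2 * j) x -> dyadic k.+1 (2 * j + 1) y -> dyadic k j z ->
  T k.+1 x + T k.+1 y = 2 * T k z.
Proof.
move=> mT xj yj zj; have [[mTk _ _] Tk /(_ j) TI] := mT k; have [[mTk1 _ _] Tk1 _] := mT k.+1.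
set L := @dyadic R k.+1 (2 * j); set D := @dyadic R k.+1 (2 * j + 1).
have mL : measurable (L : set R) by exact: measurable_dyadic.
have mD : measurable (D : set R) by exact: measurable_dyadic.
have LD := dyadic_split R k j.
have fL w : L w -> T k.+1 w - T k w = T k.+1 x - T k z.
  by move=> Lw; rewrite (Tk1 _ _ _ Lw xj) (Tk j w z) // LD; left.
have fD w : D w -> T k.+1 w - T k w = T k.+1 y - T k z.
  by move=> Dw; rewrite (Tk1 _ _ _ Dw yj) (Tk j w z) // LD; right.
move: TI; rewrite LD -/L -/D integral_setU //; last 2 first.
- apply/measurable_EFinP; apply: (measurable_funS measurableT) => //.
  by apply: measurable_funB.
- rewrite disj_set2E; apply/eqP/seteqP; split => // w [/dyadicP + /dyadicP].
  by move=> ->; lia.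
under eq_integral => w /set_mem /fL -> do over.
rewrite integral_cst // [X in (_ + X)%E](_ : _ = ((T k.+1 y - T k z) * 2 ^- k.+1)%:E).
  rewrite [X in (_ * X)%E](lebesgue_measure_dyadic R k.+1 (2 * j)) -EFinM -EFinD -mulrDl => -[] /eqP.
  rewrite mulf_eq0 invr_eq0 expf_eq0 /= pnatr_eq0 orbF => /eqP; lra.
under eq_integral => w /set_mem /fD -> do over.
by rewrite integral_cst // [X in (_ * X)%E](lebesgue_measure_dyadic R k.+1 (2 * j + 1)).
Qed.

(** The essential bound holds at every point: [T k.+1 - T k] is constant on each interval of
    generation [k.+1], so a violation at one point would fill an interval of positive measure. *)
Lemma dyadic_step_le1 (R : realType) (beta : R) (T : nat -> R -> R) :
  dyadic_martingale T ->
  (ereal_sup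
       [set (2 `^ (- (n%:R * beta)))%:E *
            'N[lebesgue_measure]_+oo[EFin \o (T n \- T n.-1)%R]
       | n in [set n : nat | (1 <= n)%N]] <= 1)%E ->
  forall k x, `|2 `^ (- (k.+1%:R * beta)) * (T k.+1 x - T k x)| <= 1.
Proof.
move=> mT growth k x.
set c := 2 `^ _; have c0 : 0 < c by rewrite powR_gt0.
rewrite normrM gtr0_norm // leNgt; apply/negP => gt1.
set f := EFin \o (T k.+1 \- T k).
have : (c%:E * 'N[lebesgue_measure]_+oo[f] <= 1)%E.
  by apply: le_trans growth; apply: ereal_sup_ubound; exists k.+1.
(* The norm at exponent [+oo] is the essential supremum only if the whole space has positive
   measure. *)
have muT : (0 < lebesgue_measure [set: R])%E.
  apply: (@lt_le_trans _ _ (lebesgue_measure (@dyadic R 0 0))).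
    by rewrite lebesgue_measure_dyadic lte_fin invr_gt0 exprn_gt0.
  by apply: le_measure; rewrite ?inE //; exact: measurable_dyadic.
rewrite unlock muT muleC -lee_pdivlMr // => /ess_supP [N [mN N0 hN]].
have : (lebesgue_measure (dyadic k.+1 (dyadic_index k.+1 x) : set R) <= 0)%E.
  rewrite -N0; apply: le_measure; rewrite ?inE //; first exact: measurable_dyadic.
  move=> y /dyadicP yx; apply: hN => /=; rewrite lee_fin => h.
  move: gt1; rewrite mulrC -ltr_pdivrMr // ltNge => /negP; apply.
  rewrite (dyadic_martingale_cst mT (leqnn _) (esym yx)).
  by rewrite (dyadic_martingale_cst mT (leqnSn _) (esym yx)).
by rewrite lebesgue_measure_dyadic lee_fin leNgt invr_gt0 exprn_gt0.
Qed.

(** * Scalar inequalities and bounded recurrences *)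

Lemma prod_expR_ln (R : realType) (n : nat) (f : nat -> R) :
  (forall k, 0 < f k) -> \prod_(k < n) f k = expR (\sum_(k < n) ln (f k)).
Proof.
by move=> f0; rewrite expR_sum; apply: eq_bigr => k _; rewrite lnK // posrE.
Qed.

(** From [ln z <= z - 1] at [z = (1 + x)^-1] comes [x / (1 + x) <= ln (1 + x)]; the restriction on
    [x] makes [x ^+ 2 * (1 + 2 * x)] nonnegative. *)
Lemma ln_ge_subr2sqr (R : realType) (x : R) : -(1 / 2) <= x ->
  x - 2 * x ^+ 2 <= ln (1 + x).
Proof.
move=> x2; have x0 : 0 < 1 + x by lra.
have h : ln (1 + - (x / (1 + x))) <= - (x / (1 + x)).
  by apply: le_ln1Dx; rewrite ltrNr opprK ltr_pdivrMr //; lra.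
have E : 1 + - (x / (1 + x)) = (1 + x)^-1 by field; lra.
rewrite E lnV ?posrE // lerN2 in h.
apply: le_trans h; rewrite ler_pdivlMr //.
have : 0 <= x ^+ 2 * (1 + 2 * x) by rewrite mulr_ge0 ?sqr_ge0 //; lra.
nra.
Qed.

(** The bound is stable under the recurrence because [1 + q / (1 - q) = 1 / (1 - q)]. *)
Lemma recurrence_bounded (R : realType) (q : R) (a : nat -> R) : 0 < q < 1 ->
  (forall k, `|a k.+1 - q * a k| <= 1) ->
  exists2 A, 0 < A & forall k, `|a k| <= A.
Proof.
move=> /andP[q0 q1] ab; have q1' : 0 < (1 - q)^-1 by rewrite invr_gt0; lra.
exists (`|a 0%N| + (1 - q)^-1); first by rewrite ltr_wpDl.
elim=> [|k IH]; first by rewrite lerDl ltW.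
rewrite -[a k.+1](subrK (q * a k)) (le_trans (ler_normD _ _)) //.
rewrite normrM (gtr0_norm q0) (le_trans (lerD (ab k) (ler_wpM2l (ltW q0) IH))) //.
have h : (1 - q) * (1 - q)^-1 = 1 by rewrite divff //; lra.
have := normr_ge0 (a 0%N); nra.
Qed.

Lemma positive_density_negative (R : realType) (q : R) (a : nat -> R) : 0 < q < 1 ->
  (forall k, `|a k.+1 - q * a k| <= 1) ->
  (forall eta, 0 < eta -> exists N, forall n, (N <= n)%N ->
     \sum_(k < n) (a k.+1 - q * a k) <= eta * n%:R) ->
  (exists2 delta : R, 0 < delta & (0 < upper_density R (fun k => (delta < a k)%R))%E) ->
  exists2 c : R, 0 < c & (0 < upper_density R (fun k => (a k < - c)%R))%E.
Proof.
move=> q01 ab aS [delta delta0 dens]; have /andP[q0 q1] := q01.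
have [A A0 aA] := recurrence_bounded q01 ab.
have [p p0 pdens] : exists2 p : R, 0 < p & (p%:E < upper_density R (fun k => (delta < a k)%R))%E.
  move: dens; case: (upper_density _ _) => [r|_|//]; last by exists 1; rewrite ?ltry.
  by rewrite lte_fin => r0; exists (r / 2); rewrite ?lte_fin; lra.
have dp0 : 0 < delta * p by rewrite mulr_gt0.
(* Values above [delta] contribute at least [delta * p] per step. Values no lower than [- c] cost a
   quarter of that and the mean of [a] is at most another quarter, so values below [- c], each at
   least [- A], account for the remaining half. *)
pose c := delta * p / 4; have c0 : 0 < c by rewrite divr_gt0.
(* Half of the quarter allowed for the mean of [a], times [1 - q]; the boundary term
   [q * (a 0 - a n)] takes the other half. *)
have [N1 hN1] := aS ((1 - q) * (delta * p / 8)) ltac:(by rewrite mulr_gt0; lra).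
pose K := 2 * A / ((1 - q) * (delta * p / 8)).
have eta0 : 0 < (1 - q) * (delta * p / 8) by rewrite mulr_gt0; lra.
exists c => //; apply: (@lt_le_trans _ _ (delta * p / 2 / A)%:E).
  by rewrite lte_fin !divr_gt0.
apply: upper_density_ge => N.
have [n Nn pn] := upper_density_gt (maxn N (maxn N1 (Num.truncn K).+1)) (ltW p0) pdens.
rewrite !geq_max in Nn; case/and3P: Nn => Nn N1n Kn.
exists n => //; rewrite mulrAC ler_pdivrMr // mulrC.
have nK : 2 * A <= (1 - q) * (delta * p / 8) * n%:R.
  rewrite [leRHS]mulrC -ler_pdivrMr // ltW // (lt_le_trans (truncnS_gt _)) //.
  by rewrite ler_nat.
have {hN1}hS := hN1 n N1n.
have sumE m : \sum_(k < m) (a k.+1 - q * a k) =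
    (1 - q) * \sum_(k < m) a k.+1 - q * (a 0%N - a m).
  elim: m => [|m IH]; first by rewrite !big_ord0; ring.
  by rewrite !big_ord_recr /= IH; ring.
rewrite sumE in hS.
have q_small : q * (a 0%N - a n) <= 2 * A.
  have := aA 0%N; have := aA n; rewrite !ler_norml => /andP[? ?] /andP[? ?].
  apply: (@le_trans _ _ (q * (2 * A))); first by apply: ler_wpM2l; lra.
  by rewrite ger_pMl; lra.
have upper : \sum_(k < n) a k.+1 <= delta * p / 4 * n%:R.
  rewrite -(@ler_pM2l _ (1 - q)); last lra.
  by move: hS nK q_small; lra.
have lower : delta * (count_to (fun k => delta < a k) n)%:R - c * n%:R
    - A * (count_to (fun k => a k < - c) n)%:R <= \sum_(k < n) a k.+1.
  rewrite !count_toE !natr_sum !mulr_sumr -[X in c * X%:R]card_ord.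
  rewrite mulr_natr -sumr_const -!sumrB; apply: ler_sum => k _.
  have := aA k.+1; rewrite ler_norml => /andP[? ?].
  by case: (ltP delta) => ?; case: (ltP (a k.+1)) => ?; rewrite /=; lra.
have : delta * (p * n%:R) <= delta * (count_to (fun k => delta < a k) n)%:R.
  by rewrite ler_pM2l.
rewrite /c in lower *; move: upper lower; lra.
Qed.

(** * The normalized martingale and its increments *)

Section Growth.
Variables (R : realType) (beta : R) (T : nat -> R -> R).
Hypotheses (beta01 : 0 < beta < 1) (martT : dyadic_martingale T).
Hypothesis stepT :
  forall k x, `|2 `^ (- (k.+1%:R * beta)) * (T k.+1 x - T k x)| <= 1.

Local Notation q := (2 `^ (- beta)).
Local Notation a := (normalized beta T).

(** In this form the normalized values obey a recurrence contracting by [q]; [incrementE] identifies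
    it with the scaled martingale difference. *)
Definition increment k x : R := a k.+1 x - q * a k x.

Lemma powR2N_lt1 : 0 < q < 1.
Proof.
have /andP[b0 b1] := beta01; rewrite powR_gt0 //= powRN invf_lt1 ?powR_gt0 //.
by rewrite -[X in X < _](powRr0 2) /powR ifF ?ifF ?gt_eqF // ltr_expR ltr_pM2r // ln_gt0; lra.
Qed.

Lemma incrementE k x :
  increment k x = 2 `^ (- (k.+1%:R * beta)) * (T k.+1 x - T k x).
Proof.
rewrite /increment /normalized mulrA -powRD ?pnatr_eq0 ?implybT //.
rewrite (_ : - beta - k%:R * beta = - (k.+1%:R * beta)); last by rewrite -natr1; ring.
by ring.
Qed.

Lemma increment_cst k x y :
  dyadic_index k.+1 x = dyadic_index k.+1 y -> increment k x = increment k y.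
Proof.
move=> xy; rewrite !incrementE (dyadic_martingale_cst martT (leqnn _) xy).
by rewrite (dyadic_martingale_cst martT (leqnSn _) xy).
Qed.

Lemma increment_mean k j : increment k (dyadic_point R k.+1 (2 * j)) +
  increment k (dyadic_point R k.+1 (2 * j + 1)) = 0.
Proof.
set x := dyadic_point R _ _; set y := dyadic_point R _ _.
have xj : dyadic_index k x = j by rewrite /x dyadic_point_left dyadic_pointK.
have yj : dyadic_index k y = j by rewrite /y dyadic_point_right.
have xy : T k x = T k y.
  by apply: (dyadic_martingale_cst martT (leqnn _)); rewrite xj yj.
have m : T k.+1 x + T k.+1 y = 2 * T k x.
  by apply: (dyadic_martingale_mean (j := j) martT); apply/dyadicP;
    rewrite ?dyadic_pointK.
by rewrite !incrementE -mulrDr -xy addrACA m; ring.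
Qed.

Lemma increment_le1 k x : `|increment k x| <= 1.
Proof. by rewrite incrementE. Qed.

(** Common to [F_set] and [G_set]: a small average deficit for infinitely many [n] makes the product
    at least [expR (n * (chord eta + kappa))] by [sum_ln_ge], and [chord_entropy] converts this to
    the exponent [entropy eta]. *)
Lemma deficit_covered (gamma : R) (E : set R) : 0 < gamma < 1 ->
  (forall x, E x -> forall rho N, 0 < rho -> exists2 n, (N <= n)%N &
     \sum_(k < n) Num.max 0 (gamma - a k.+1 x) <= rho * n%:R) ->
  negligibly_covered (entropy (gamma * (1 - q))) E.
Proof.
move=> g01 hE; have /andP[q0 q1] := powR2N_lt1; have /andP[g0 g1] := g01.
set eta := gamma * (1 - q).
have eta01 : 0 < eta < 1 by apply/andP; rewrite /eta; split; nra.
have [kappa [rho [kappa0 rho0 H]]] := sum_ln_ge powR2N_lt1 g01.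
apply: (increments_coverage increment_cst increment_mean increment_le1 eta01 kappa0).
move=> x Ex N; have [A _ aA] := recurrence_bounded powR2N_lt1 (increment_le1^~ x).
have [N0 hN0] := H _ A aA (increment_le1^~ x).
have [n] := hE _ Ex rho (maxn N N0) rho0; rewrite geq_max => /andP[Nn N0n].
move=> /(hN0 _ N0n); rewrite -/eta => hn; exists n => //.
rewrite (@prod_expR_ln _ n (fun k => 1 + eta * increment k x)) => [|k]; last first.
  have := increment_le1 k x; have /andP[? ?] := eta01.
  by rewrite ler_norml => /andP[? ?]; nra.
have -> : 2 ^- n = expR (- (n%:R * ln 2)) :> R.
  by rewrite expRN expRM_natl lnK // posrE.
rewrite -expRM -!expRD ler_expR chord_entropy // in hn *.
move: hn; rewrite /increment; lra.
Qed.

Lemma F_set_covered gamma : 0 < gamma < 1 ->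
  negligibly_covered (entropy (gamma * (1 - q))) (F_set beta T gamma).
Proof.
move=> g01; apply: deficit_covered => // x Fx rho N rho0.
have [A A0 aA] := recurrence_bounded powR2N_lt1 (increment_le1^~ x).
have [N1 hN1] : exists N1, forall n, (N1 <= n)%N -> gamma - rho / 2 < a n x.
  have [|N1 hN1] := @limn_einf_lt R (fun k => (a k x)%:E) (gamma - rho / 2)%:E.
    by apply: lt_le_trans Fx; rewrite lte_fin; lra.
  by exists N1 => n /hN1; rewrite lte_fin.
have v_le k : Num.max 0 (gamma - a k x) <= gamma + A.
  have /andP[g0 _] := g01; have := aA k; rewrite ler_norml => /andP[? ?].
  by rewrite ge_max; apply/andP; split; lra.
have bound n : \sum_(k < n) Num.max 0 (gamma - a k.+1 x) <=
    N1%:R * (gamma + A) + n%:R * (rho / 2).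
  (* The first [N1] terms are bounded by [gamma + A], the later ones by [rho / 2]; [minn] lets the
     induction run over all [n]. *)
  apply: (@le_trans _ _ ((minn n N1)%:R * (gamma + A) + n%:R * (rho / 2))); last first.
    by rewrite lerD2r ler_wpM2r ?ler_nat ?geq_minr //; have /andP[] := g01; lra.
  elim: n => [|n IH]; first by rewrite big_ord0 min0n !mul0r addr0.
  rewrite big_ord_recr /=; apply: le_trans (lerD IH (lexx _)) _.
  have nS : n.+1%:R = n%:R + 1 :> R by rewrite natr1.
  rewrite nS; have [nN1|N1n] := ltnP n N1.
    by rewrite !(minn_idPl _) ?(ltnW nN1) // nS; have := v_le n.+1; lra.
  rewrite !(minn_idPr _) ?(leqW N1n) //.
  suff : Num.max 0 (gamma - a n.+1 x) <= rho / 2 by lra.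
  by rewrite ge_max; have := hN1 n.+1 (leqW N1n); move=> ?; apply/andP; split; lra.
pose K := N1%:R * (gamma + A) / (rho / 2).
exists (maxn N (Num.truncn K).+1); first exact: leq_maxl.
apply: (le_trans (bound _)); set n := maxn _ _.
have : K <= n%:R.
  by rewrite ltW // (lt_le_trans (truncnS_gt _)) // ler_nat leq_maxr.
rewrite ler_pdivrMr; lra.
Qed.

Lemma G_set_covered gamma : 0 < gamma < 1 ->
  negligibly_covered (entropy (gamma * (1 - q))) (G_set beta T gamma).
Proof.
move=> g01; apply: deficit_covered => // x Gx rho N rho0.
have [A A0 aA] := recurrence_bounded powR2N_lt1 (increment_le1^~ x).
have v_le k : Num.max 0 (gamma - a k x) <=
    (gamma + A) * (1 - (gamma <= a k x)%R%:R).
  have /andP[g0 _] := g01; have := aA k; rewrite ler_norml => /andP[? ?].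
  by rewrite ge_max; case: (lerP gamma (a k x)) => ? /=; apply/andP; split; lra.
have /andP[g0 g1] := g01.
(* Deficits are at most [gamma + A] and occur only where [a k x < gamma], so a proportion
   [1 - rho / (gamma + A)] of other indices suffices. It is below the density 1; the maximum with 0
   meets the sign condition of [upper_density_gt]. *)
pose p := Num.max 0 (1 - rho / (gamma + A)).
have rho' : 0 < rho / (gamma + A) by rewrite divr_gt0 // addr_gt0.
have [||n Nn pn] := @upper_density_gt R (fun k => gamma <= a k x) p N.
- by rewrite le_max lexx.
- by rewrite Gx lte_fin gt_max ltr01 /=; lra.
exists n => //; apply: (@le_trans _ _
    (\sum_(k < n) (gamma + A) * (1 - (gamma <= a k.+1 x)%R%:R))).
  by apply: ler_sum => k _; exact: v_le.
rewrite -mulr_sumr sumrB sumr_const card_ord -natr_sum.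
rewrite -(count_toE (fun k => gamma <= a k x)).
rewrite mulrC -ler_pdivlMr; last lra.
have : (1 - rho / (gamma + A)) * n%:R <= p * n%:R.
  by apply: ler_wpM2r => //; rewrite le_max lexx orbT.
rewrite mulrAC in rho' *; lra.
Qed.

Lemma increments_sum_ae : {ae lebesgue_measure, forall x : R,
  forall eta, 0 < eta -> exists N, forall n, (N <= n)%N ->
     \sum_(k < n) increment k x <= eta * n%:R}.
Proof.
(* The thresholds [1 / (i + 1)] reduce the quantifier over [eta] to a countable union of negligible
   sets. *)
pose E i := [set x : R | forall N, exists2 n, (N <= n)%N &
  i.+1%:R^-1 * n%:R <= \sum_(k < n) increment k x].
have negE i : lebesgue_measure.-negligible (E i).
  apply: lebesgue_negligible; set eta : R := i.+1%:R^-1.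
  have eta0 : 0 < eta by rewrite invr_gt0 ltr0n.
  have eta1 : eta <= 1 by rewrite invf_le1 ?ltr0n // ler1n.
  (* With [t = eta / 4] the linear term gains on average at least [eta ^+ 2 / 4] per step and the
     quadratic one loses at most [eta ^+ 2 / 8], which leaves [kappa = eta ^+ 2 / 8]. *)
  have t01 : 0 < eta / 4 < 1 by apply/andP; split; lra.
  have kappa0 : 0 < eta ^+ 2 / 8 by rewrite divr_gt0 // exprn_gt0.
  apply: (increments_coverage increment_cst increment_mean increment_le1 t01 kappa0).
  move=> x Ex N; have [n Nn hn] := Ex N; exists n => //.
  rewrite powRr1 ?invr_ge0 ?exprn_ge0 // mulrC ler_wpM2l ?invr_ge0 ?exprn_ge0 //.
  have b1 k : -1 <= increment k x <= 1 by rewrite -ler_norml increment_le1.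
  rewrite (@prod_expR_ln _ n (fun k => 1 + eta / 4 * increment k x)) => [|k]; last first.
    by have /andP[? ?] := b1 k; nra.
  rewrite ler_expR; apply: (@le_trans _ _
      (\sum_(k < n) (eta / 4 * increment k x - eta ^+ 2 / 8))).
    rewrite sumrB -mulr_sumr sumr_const card_ord -mulr_natl.
    have : eta / 4 * (eta * n%:R) <= eta / 4 * \sum_(k < n) increment k x.
      by rewrite ler_pM2l //; lra.
    by rewrite -/eta; lra.
  apply: ler_sum => k _; have /andP[? ?] := b1 k.
  apply: le_trans (ln_ge_subr2sqr _); last by nra.
  have : (eta / 4 * increment k x) ^+ 2 <= (eta / 4) ^+ 2.
    by rewrite exprMn ler_piMr ?sqr_ge0 //; nra.
  by lra.
have := negligible_bigcup negE; apply: negligibleS => x /= hx.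
apply: contrapT => nE; apply: hx => eta eta0.
have [i hi] : exists i, i.+1%:R^-1 <= eta.
  exists (Num.truncn eta^-1); rewrite invf_ple ?posrE ?ltr0n //.
  by rewrite ltW // truncnS_gt.
have : ~ E i x by move=> Eix; apply: nE; exists i.
move=> /existsNP [N hN]; exists N => n Nn; rewrite leNgt; apply/negP => h.
apply: hN; exists n => //; apply: le_trans (ltW h).
by apply: ler_wpM2r.
Qed.

End Growth.

(** * From negligible covers to the three assertions *)

Lemma hausdorff_bounds (R : realType) (s : R) (E : set R) : 0 < s ->
  negligibly_covered s E ->
  (hausdorff_measure s E <= 1)%E /\ (hausdorff_dim E <= s%:E)%E.
Proof.
move=> s0 /hausdorff_measure_eq0 E0; rewrite E0 lee_fin ler01; split => //.
by apply: ereal_inf_lbound; exists s => //=; rewrite E0 ltry.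
Qed.

Theorem corollary1 (R : realType) (beta : R) (T : nat -> R -> R)
    (beta01 : 0 < beta < 1)
    (martT : dyadic_martingale T)
    (growthT : (ereal_sup
       [set (2 `^ (- (n%:R * beta)))%:E *
            'N[lebesgue_measure]_+oo[EFin \o (T n \- T n.-1)%R]
       | n in [set n : nat | (1 <= n)%N]] <= 1)%E) :
  (* (a) *)
  (forall gamma : R, 0 < gamma < 1 ->
     (hausdorff_measure (entropy (gamma * (1 - 2 `^ (- beta))))
        (G_set beta T gamma) <= 1)%E /\
     (hausdorff_dim (G_set beta T gamma) <=
        (entropy (gamma * (1 - 2 `^ (- beta))))%:E)%E) /\
  (* (b) *)
  (forall gamma : R, 0 < gamma < 1 ->
     (hausdorff_measure (entropy (gamma * (1 - 2 `^ (- beta))))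
        (F_set beta T gamma) <= 1)%E /\
     (hausdorff_dim (F_set beta T gamma) <=
        (entropy (gamma * (1 - 2 `^ (- beta))))%:E)%E) /\
  (* (c) *)
  {ae lebesgue_measure, forall x : R,
     (exists2 delta : R, 0 < delta &
        (0 < upper_density R (fun k => delta < normalized beta T k x)%R)%E) ->
     exists2 c : R, 0 < c &
        (0 < upper_density R (fun k => normalized beta T k x < - c)%R)%E}.
Proof.
have stepT := dyadic_step_le1 martT growthT.
have /andP[q0 q1] := powR2N_lt1 beta01.
have entropy0 gamma : 0 < gamma < 1 -> 0 < entropy (gamma * (1 - 2 `^ (- beta))).
  by move=> /andP[? ?]; apply: entropy_gt0; apply/andP; split; nra.
split=> [gamma g01|].
  by apply: hausdorff_bounds; [exact: entropy0|exact: G_set_covered].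
split=> [gamma g01|].
  by apply: hausdorff_bounds; [exact: entropy0|exact: F_set_covered].
have := increments_sum_ae martT stepT.
apply: filterS; first exact: (ae_filter_ringOfSetsType lebesgue_measure).
move=> x Sx.
apply: (positive_density_negative (a := normalized beta T ^~ x) (powR2N_lt1 beta01)) => //.
by move=> k; exact: (increment_le1 stepT k x).
Qed.
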